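(* Let $n \ge 1$, $q \ge 2$ and $1 \le p \le n$ be integers. Then \[\chi\bigl(H(n, q)^p\bigr) \ge 1 + \frac{\sum_{i = 1}^p (q - 1)^i \binom{n}{i}}{-\min\limits_{1 \le k \le n}\left\{\sum_{i = 1}^p \mathcal{K}_i(k; n, q)\right\}}.\]
   Context: $\chi(G)$ denotes the chromatic number of a graph $G$. The Hamming graph $H(n,q)$ has vertex set $\mathbb{Z}_q^n$ (length-$n$ strings over a $q$-ary alphabet), two strings being adjacent iff they differ in exactly one position; its diameter is $n$. For a graph $G$ and $p\ge 1$, the power $G^p$ has the same vertex set as $G$, two distinct vertices being adjacent iff their shortest-path distance in $G$ is at most $p$. For integers $n,q\ge 1$ and $0\le i\le n$, the Kravchuk polynomial is $\mathcal{K}_i(x; n, q) = \sum_{j = 0}^i (-1)^j (q - 1)^{i - j} \binom{x}{j} \binom{n - x}{i - j}$. Convention: $\binom{a}{b} = 0$ whenever $a < b$. *)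

(* Defs.v *)
From mathcomp Require Import all_boot all_order all_algebra.

Set Implicit Arguments.
Unset Strict Implicit.
Unset Printing Implicit Defensive.

Import Order.TTheory GRing.Theory Num.Theory.
Local Open Scope ring_scope.

Record sgraph := SGraph {
  vertex :> finType;
  adj : rel vertex;
  adj_sym : symmetric adj;
  adj_irr : irreflexive adj }.

Section Distance.
Variable G : sgraph.
Implicit Types x y : G.

Definition walk (k : nat) x y : bool :=
  [exists s : k.-tuple G, path (@adj G) x s && (last x s == y)].

Lemma connect_walk x y : connect (@adj G) x y -> exists k, walk k x y.
Proof.
case/connectP=> s xs ->; exists (size s).
by apply/existsP; exists (in_tuple s); rewrite /= xs eqxx.
Qed.

Lemma walk_sym k : symmetric (walk k).
Proof.
suff W x y : walk k x y -> walk k y x by move=> x y; apply/idP/idP; apply: W.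
case/existsP=> s /andP[xs /eqP <-]; apply/existsP.
have sz : size (rev (belast x s)) == k by rewrite size_rev size_belast size_tuple.
exists (Tuple sz); rewrite /= rev_path.
rewrite (eq_path (e' := @adj G)) ?xs /=; last by move=> a b; rewrite adj_sym.
by case: (tval s) => [|a s'] //=; rewrite rev_cons last_rcons.
Qed.

Lemma connect_adj_sym : connect_sym (@adj G).
Proof. exact/sym_connect_sym/adj_sym. Qed.

(* Length of a shortest path; None when there is no path at all. *)
Definition gdist x y : option nat :=
  if @idP (connect (@adj G) x y) is ReflectT xy
  then Some (ex_minn (connect_walk xy)) else None.

Lemma gdist_sym x y : gdist x y = gdist y x.
Proof.
rewrite /gdist; case: {-}_ / idP => [xy|xy]; case: {-}_ / idP => [yx|yx] //.
- congr Some; case: ex_minnP => a wa mina; case: ex_minnP => b wb minb.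
  by apply/eqP; rewrite eqn_leq mina ?minb // walk_sym.
- by rewrite connect_adj_sym xy in yx.
- by rewrite connect_adj_sym yx in xy.
Qed.

End Distance.

Section Power.
Variables (G : sgraph) (p : nat).

Definition power_adj : rel G := fun x y =>
  (x != y) && (if gdist x y is Some d then (d <= p)%N else false).

Lemma power_adj_sym : symmetric power_adj.
Proof. by move=> x y; rewrite /power_adj gdist_sym eq_sym. Qed.

Lemma power_adj_irr : irreflexive power_adj.
Proof. by move=> x; rewrite /power_adj eqxx. Qed.

Definition graph_power : sgraph := SGraph power_adj_sym power_adj_irr.
End Power.

Section Chromatic.
Variable G : sgraph.

Definition colorable (k : nat) : bool :=
  [exists c : {ffun G -> 'I_k}, [forall x, forall y, adj x y ==> (c x != c y)]].

Lemma colorable_exists : exists k, colorable k.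
Proof.
exists #|G|; apply/existsP; exists [ffun x => enum_rank x].
apply/forallP=> x; apply/forallP=> y; apply/implyP=> xy; rewrite !ffunE.
by apply: contraTneq xy => /enum_rank_inj ->; rewrite adj_irr.
Qed.

Definition chromatic_number : nat := ex_minn colorable_exists.
End Chromatic.

Section Hamming.
Variables n q : nat.

Definition hamming_adj : rel {ffun 'I_n -> 'I_q} := fun x y =>
  #|[set i | x i != y i]| == 1%N.

Lemma hamming_adj_sym : symmetric hamming_adj.
Proof.
move=> x y; rewrite /hamming_adj; congr (_ == _).
by apply: eq_card => i; rewrite !inE eq_sym.
Qed.

Lemma hamming_adj_irr : irreflexive hamming_adj.
Proof.
move=> x; rewrite /hamming_adj (_ : [set i | _] = set0) ?cards0 //.
by apply/setP=> i; rewrite !inE eqxx.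
Qed.

Definition hamming : sgraph := SGraph hamming_adj_sym hamming_adj_irr.
End Hamming.

(* The value at a natural number x; since n - x is truncated, this is the
   Kravchuk polynomial only for x <= n. *)
Definition kravchuk (i x n q : nat) : rat :=
  \sum_(0 <= j < i.+1)
    (-1) ^+ j * (q%:R - 1) ^+ (i - j) * 'C(x, j)%:R * 'C(n - x, i - j)%:R.

(* For n >= 1 the initial value F 1 is itself one of F 1, ..., F n, so this is
   their minimum. *)
Definition min_range (n : nat) (F : nat -> rat) : rat :=
  \big[Num.min/F 1%N]_(1 <= k < n.+1) F k.

(* Main.v *)
(* Hoffman's ratio bound.  Let [J] be the all-ones [q x q] matrix and [P = J/q].
   For a set [S] of coordinates, let [E_S] be the tensor product of [1 - P] over
   the coordinates in [S] and [P] over the others: these are orthogonal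
   projections summing to the identity.  Expanding the tensor power of
   [1 + t (J - 1) = (1 - t)(1 - P) + (1 + (q - 1) t) P] shows that the matrix of
   the relation "at distance i" acts on the image of [E_S] by the coefficient of
   [t^i] in [(1 - t)^|S| (1 + (q - 1) t)^(n - |S|)], which is [K_i(|S|)].  So the
   adjacency form of the p-th power dominates
   [m |f|^2 + (d - m) (sum f)^2 / q^n], with [d] the degree and [m] the minimum
   in the theorem.  The adjacency form vanishes at the indicator of a colour
   class [C], whence [(d - m) |C| <= - m q^n] when [m < 0]; sum over the colours. *)
Require Import Defs.
From mathcomp Require Import all_boot all_order all_algebra.
From mathcomp Require Import ring.

Set Implicit Arguments.
Unset Strict Implicit.
Unset Printing Implicit Defensive.

Import Order.TTheory GRing.Theory Num.Theory.
Local Open Scope ring_scope.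

(** * Hamming distance and adjacency in the power *)

Section HammingDistance.
Variables n q : nat.
Implicit Types x y : {ffun 'I_n -> 'I_q}.

Definition hdist x y : nat := #|[set i | x i != y i]|.

(** Correcting the differing coordinates one at a time is a walk, so the graph distance is at most
    [hdist x y]. *)
Lemma hdist_walk x y : walk (G := hamming n q) (hdist x y) x y.
Proof.
move eqk: (hdist x y) => k; elim: k => [|k IHk] in x eqk *.
  apply/existsP; exists [tuple] => /=; apply/eqP/ffunP => i.
  move/eqP: eqk; rewrite cards_eq0 => /eqP/setP/(_ i).
  by rewrite !inE => /negbFE/eqP.
have /card_gt0P[i] : (0 < #|[set i | x i != y i]|)%N.
  by rewrite -/(hdist x y) eqk.
rewrite inE => xyi.
pose z : {ffun 'I_n -> 'I_q} := [ffun j => if j == i then y i else x j].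
have zyk : hdist z y = k.
  apply: succn_inj; rewrite -eqk /hdist [in RHS](cardsD1 i) inE xyi add1n.
  congr _.+1; apply: eq_card => j; rewrite !inE ffunE.
  by case: (j =P i) => [->|]; rewrite ?eqxx.
have /existsP[s /andP[zs lasts]] := IHk z zyk.
apply/existsP; exists [tuple of z :: s] => /=; rewrite zs lasts !andbT.
rewrite /hamming_adj (_ : [set _ | _] = [set i]) ?cards1 //.
apply/setP => j; rewrite !inE ffunE.
by case: (j =P i) => [->|]; rewrite ?eqxx.
Qed.

Lemma power_adj_hdist p x y :
  (1 <= hdist x y <= p)%N -> power_adj (G := hamming n q) p x y.
Proof.
case/andP=> xy_gt0 xy_le; apply/andP; split.
  apply: contraTneq xy_gt0 => ->; rewrite lt0n negbK cards_eq0.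
  by apply/eqP/setP => i; rewrite !inE eqxx.
have W := hdist_walk x y.
rewrite /gdist; case: {-}_ / idP => [xy|[]]; last first.
  by case/existsP: W => s /andP[xs /eqP <-]; apply/connectP; exists s.
by case: ex_minnP => d _ /(_ _ W) le_d; apply: leq_trans xy_le.
Qed.

End HammingDistance.

(** * The projections [E_S] and their quadratic forms *)

Section CoordinateProjections.
Variables n q : nat.
Hypothesis q_gt0 : (0 < q)%N.
Local Notation V := {ffun 'I_n -> 'I_q}.
Implicit Types (x y : V) (S : {set 'I_n}) (f : V -> rat).

(** Entries of [1 - P] for [true] and of [P] for [false], so that [proj S] is [E_S]. *)
Definition proj1 (b : bool) (u v : 'I_q) : rat :=
  if b then (u == v)%:R - q%:R^-1 else q%:R^-1.

Definition proj S x y : rat := \prod_i proj1 (i \in S) (x i) (y i).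

Let q_neq0 : (q%:R : rat) != 0.
Proof. by rewrite pnatr_eq0 -lt0n. Qed.

(** Summing over the first index of both factors combines symmetry and idempotence into [A^T A = A],
    the form that yields squares. *)
Lemma proj1_idem b u v : \sum_w proj1 b w u * proj1 b w v = proj1 b u v.
Proof.
have cst (c : rat) : \sum_(w < q) c = q%:R * c.
  by rewrite sumr_const card_ord mulr_natl.
have dirac (F : 'I_q -> rat) a : \sum_w (w == a)%:R * F w = F a.
  rewrite (bigD1 a) //= eqxx mul1r big1 ?addr0 // => w /negPf ->.
  by rewrite mul0r.
case: b; rewrite /proj1; last by rewrite cst; field.
under eq_bigr do rewrite mulrBl.
rewrite sumrB dirac -mulr_sumr sumrB cst.
under eq_bigr do rewrite -[_%:R]mulr1.
by rewrite dirac; field.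
Qed.

Lemma proj_idem S x y : \sum_z proj S z x * proj S z y = proj S x y.
Proof.
transitivity (\sum_(z : V) \prod_i
    (proj1 (i \in S) (z i) (x i) * proj1 (i \in S) (z i) (y i))).
  by apply: eq_bigr => z _; rewrite big_split.
rewrite -(bigA_distr_bigA (fun i w =>
  proj1 (i \in S) w (x i) * proj1 (i \in S) w (y i))).
by apply: eq_bigr => i _; apply: proj1_idem.
Qed.

Definition qform (A : V -> V -> rat) f : rat :=
  \sum_x \sum_y f x * f y * A x y.

(** By [E^T E = E], the form at [f] is the squared norm of [E f]. *)
Lemma qform_proj_ge0 S f : 0 <= qform (proj S) f.
Proof.
rewrite (_ : qform _ f = \sum_z (\sum_x f x * proj S z x) ^+ 2).
  by apply: sumr_ge0 => z _; apply: sqr_ge0.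
under [RHS]eq_bigr do rewrite expr2 mulr_suml.
rewrite exchange_big; apply: eq_bigr => x _.
under [RHS]eq_bigr do rewrite mulr_sumr.
rewrite exchange_big; apply: eq_bigr => y _.
rewrite -proj_idem mulr_sumr; apply: eq_bigr => z _; ring.
Qed.

Lemma qform_lincomb (l : {set 'I_n} -> rat) f :
  qform (fun x y => \sum_(S : {set 'I_n}) l S * proj S x y) f =
  \sum_(S : {set 'I_n}) l S * qform (proj S) f.
Proof.
under [RHS]eq_bigr do rewrite mulr_sumr.
rewrite exchange_big; apply: eq_bigr => x _.
under [RHS]eq_bigr do rewrite mulr_sumr.
rewrite exchange_big; apply: eq_bigr => y _.
by rewrite mulr_sumr; apply: eq_bigr => S _; ring.
Qed.

Lemma qform_proj0 f : qform (proj set0) f = (\sum_x f x) ^+ 2 / q%:R ^+ n.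
Proof.
rewrite expr2 !mulr_suml; apply: eq_bigr => x _.
rewrite mulr_sumr mulr_suml; apply: eq_bigr => y _; congr (_ * _).
rewrite /proj (eq_bigr (fun=> q%:R^-1)); last by move=> i _; rewrite inE.
by rewrite prodr_const card_ord exprVn.
Qed.

(** * Kravchuk values as eigenvalues *)

Definition eigenpoly k : {poly rat} :=
  (1 + (-1) *: 'X) ^+ k * (1 + (q%:R - 1) *: 'X) ^+ (n - k).

(** The entries of [1 + t (J - 1)] are 1 on the diagonal and [t] off it, so their product over the
    coordinates is [t^(hdist x y)]; distributing [F i + G i] gives one term for each [S]. *)
Lemma hdist_expansion x y :
  'X^(hdist x y) =
  \sum_(S : {set 'I_n}) (eigenpoly #|S| * (proj S x y)%:P) :> {poly rat}.
Proof.
pose F i : {poly rat} := (1 + (-1) *: 'X) * (proj1 true (x i) (y i))%:P.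
pose G i : {poly rat} := (1 + (q%:R - 1) *: 'X) * (proj1 false (x i) (y i))%:P.
have -> : 'X^(hdist x y) = \prod_i (F i + G i).
  rewrite -prodr_const [LHS]big_mkcond /=; apply: eq_bigr => i _.
  rewrite inE /F /G /proj1 -!mul_polyC !rmorphB /=.
  have : (q%:R : rat)%:P * (q%:R^-1)%:P = 1 :> {poly rat}.
    by rewrite -rmorphM /= mulfV.
  set a := _%:P; set b := _%:P => ab.
  have -> : (x i == y i)%:R%:P = (x i == y i)%:R :> {poly rat}.
    by rewrite polyC_natr.
  case: eqP => _ /=; rewrite ?polyC1 ?polyCN ?polyC1.
    (* To [ring], [a] and [b] are unrelated atoms, so [a * b] is put in place of 1 beforehand. *)
    by transitivity (1 + (a * b - 1) * 'X : {poly rat}); [rewrite ab|]; ring.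
  by transitivity (a * b * 'X : {poly rat}); [rewrite ab|]; ring.
rewrite bigA_distr; apply: eq_bigr => S _.
have -> : eigenpoly #|S| = \prod_i (if i \in S then 1 + (-1) *: 'X
                                    else 1 + (q%:R - 1) *: 'X).
  rewrite (bigID (mem S)) /=; congr (_ * _).
    by rewrite -prodr_const; apply: eq_bigr => i ->.
  have -> : (n - #|S| = #|~: S|)%N by rewrite [RHS]cardsCs setCK card_ord.
  rewrite -prodr_const; apply: eq_big => [i|i]; rewrite !inE //.
  by move/negPf->.
rewrite /proj rmorph_prod -big_split /=; apply: eq_bigr => i _.
by case: ifP.
Qed.

Lemma coef_expr1DZX (R : comNzRingType) (a : R) m j :
  ((1 + a *: 'X) ^+ m)`_j = a ^+ j * 'C(m, j)%:R.
Proof.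
rewrite exprDn coef_sum.
under eq_bigr do rewrite expr1n mul1r exprZn coefMn coefZ coefXn.
have [jm|mj] := leqP j m; last first.
  rewrite bin_small // mulr0 big1 // => i _.
  by rewrite eq_sym ltn_eqF ?mulr0 ?mul0rn // (leq_ltn_trans _ mj) // -ltnS.
have jm' : (j < m.+1)%N by [].
rewrite (bigD1 (Ordinal jm')) //= eqxx mulr1 big1 ?addr0 ?mulr_natr // => i.
by rewrite -val_eqE eq_sym => /negPf /= ->; rewrite mulr0 mul0rn.
Qed.

Lemma coef_eigenpoly k i : (eigenpoly k)`_i = kravchuk i k n q.
Proof.
rewrite coefM /kravchuk big_mkord; apply: eq_bigr => j _.
by rewrite !coef_expr1DZX; ring.
Qed.

Variable p : nat.

Definition eigenvalue k : rat := \sum_(1 <= i < p.+1) kravchuk i k n q.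

Lemma eigenvalue0 :
  eigenvalue 0 = \sum_(1 <= i < p.+1) (q%:R - 1) ^+ i * 'C(n, i)%:R.
Proof.
apply: eq_bigr => i _.
by rewrite -coef_eigenpoly /eigenpoly mul1r subn0 coef_expr1DZX.
Qed.

(** Add up the coefficients of degrees 1 to [p] in the expansion of [X^(hdist x y)]. *)
Lemma hdist_spectral x y :
  (1 <= hdist x y <= p)%N%:R =
  \sum_(S : {set 'I_n}) eigenvalue #|S| * proj S x y.
Proof.
transitivity (\sum_(1 <= i < p.+1) ('X^(hdist x y) : {poly rat})`_i).
  under [RHS]eq_bigr do rewrite coefXn mulrb.
  by rewrite -big_mkcond big_nat1_eq ltnS mulrb.
under eq_bigr do rewrite hdist_expansion coef_sum.
rewrite exchange_big; apply: eq_bigr => S _; rewrite mulr_suml.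
by apply: eq_bigr => i _; rewrite coefMC coef_eigenpoly.
Qed.

(** Constant coefficients of the same expansion, each [eigenpoly] having constant term 1. *)
Lemma sum_proj x y : \sum_(S : {set 'I_n}) proj S x y = (x == y)%:R.
Proof.
have := congr1 (fun P : {poly rat} => P`_0) (hdist_expansion x y).
rewrite coef_sum coefXn => E.
transitivity ((0%N == hdist x y)%:R : rat).
  rewrite E; apply: eq_bigr => S _.
  by rewrite coefMC coefM big_ord1 !coef_expr1DZX !expr0 !bin0 !mul1r.
congr (_%:R); rewrite eq_sym cards_eq0; congr nat_of_bool.
apply/eqP/eqP => [/setP xy|->]; last by apply/setP => i; rewrite !inE eqxx.
by apply/ffunP => i; have := xy i; rewrite !inE => /negbFE/eqP.
Qed.

Lemma ratio_bound f m :
  (forall k, (1 <= k <= n)%N -> m <= eigenvalue k) ->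
  m * (\sum_x f x ^+ 2) + (eigenvalue 0 - m) * ((\sum_x f x) ^+ 2 / q%:R ^+ n)
    <= qform (fun x y => (1 <= hdist x y <= p)%N%:R) f.
Proof.
move=> m_min.
have -> : \sum_x f x ^+ 2 = \sum_(S : {set 'I_n}) qform (proj S) f.
  rewrite exchange_big; apply: eq_bigr => x _.
  rewrite exchange_big (bigD1 x) //= [X in _ + X]big1 ?addr0.
    by rewrite -mulr_sumr sum_proj eqxx mulr1 expr2.
  move=> y yx; rewrite -mulr_sumr sum_proj.
  by rewrite eq_sym (negPf yx) mulr0.
have -> : qform (fun x y => (1 <= hdist x y <= p)%N%:R) f =
          \sum_(S : {set 'I_n}) eigenvalue #|S| * qform (proj S) f.
  rewrite -qform_lincomb; apply: eq_bigr => x _; apply: eq_bigr => y _.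
  by rewrite hdist_spectral.
rewrite -qform_proj0 mulr_sumr (bigD1 set0) //= [leRHS](bigD1 set0) //= cards0.
(* The terms of the empty set, with coefficients [m] and [eigenvalue 0 - m], add up to the one on
   the right and cancel. *)
rewrite -addrA [X in _ + X <= _]addrC addrA -mulrDl addrCA subrr addr0.
rewrite lerD2l; apply: ler_sum => S S_neq0.
apply: ler_wpM2r; first exact: qform_proj_ge0.
apply: m_min; rewrite card_gt0 S_neq0 /=.
by rewrite -[leqRHS](card_ord n) max_card.
Qed.

End CoordinateProjections.

(** * From the ratio bound to the chromatic number *)

Lemma min_range_le n (F : nat -> rat) k :
  (1 <= k <= n)%N -> min_range n F <= F k.
Proof.
move=> k_n; have : k \in index_iota 1 n.+1 by rewrite mem_index_iota ltnS.
rewrite /min_range; elim: (index_iota 1 n.+1) => // a s IHs.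
rewrite inE big_cons ge_min => /predU1P[->|/IHs ->]; first by rewrite lexx.
exact: orbT.
Qed.

Theorem theorem3p3 (n q p : nat)
    (hn : (1 <= n)%N) (hq : (2 <= q)%N) (hp : (1 <= p <= n)%N) :
  (chromatic_number (graph_power (hamming n q) p))%:R >=
    1 + (\sum_(1 <= i < p.+1) (q%:R - 1) ^+ i * 'C(n, i)%:R)
        / (- min_range n (fun k => \sum_(1 <= i < p.+1) kravchuk i k n q))
    :> rat.
Proof.
have q_gt0 : (0 < q)%N by apply: ltnW.
have q1_ge0 : 0 <= (q%:R : rat) - 1 by rewrite subr_ge0 ler1n.
rewrite /chromatic_number; case: ex_minnP => k /existsP[c /forallP c_proper] _.
set m := min_range n _.
have m_min j : (1 <= j <= n)%N -> m <= eigenvalue n q p j.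
  exact: min_range_le.
rewrite -eigenvalue0; set d := eigenvalue n q p 0.
(* If [0 <= m], the quotient is at most 0, being 0 by convention when [m = 0]; then [1 <= k]
   suffices, and some vertex has a colour. *)
have [m_ge0|m_lt0] := lerP 0 m.
  have k_gt0 : (0 < k)%N.
    by apply: leq_ltn_trans (ltn_ord (c [ffun=> Ordinal q_gt0])).
  have d_ge0 : 0 <= d.
    rewrite /d eigenvalue0; apply: sumr_ge0 => i _.
    by rewrite mulr_ge0 ?exprn_ge0 ?ler0n.
  rewrite (@le_trans _ _ 1) ?ler1n // gerDl.
  by rewrite invrN mulrN oppr_le0 divr_ge0.
have Nm_gt0 : 0 < - m by rewrite oppr_gt0.
have class_bound (a : 'I_k) :
    (d - m) * ((\sum_x (c x == a)%:R) / q%:R ^+ n) <= - m.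
  set s := \sum_x _.
  have s_ge0 : 0 <= s by apply: sumr_ge0 => x _; apply: ler0n.
  (* The class size [s] is cancelled below; for an empty class the claim is just [0 <= - m]. *)
  have [s_gt0|s_le0] := ltrP 0 s; last first.
    have -> : s = 0 by apply/le_anti; rewrite s_le0.
    by rewrite mul0r mulr0 ltW.
  have := @ratio_bound n q q_gt0 p (fun x => (c x == a)%:R) m m_min.
  rewrite (_ : \sum_x _ ^+ 2 = s); last first.
    by apply: eq_bigr => x _; case: eqP => _; rewrite ?expr1n ?expr0n.
  (* Vertices at Hamming distance between 1 and [p] have distinct colours, so one of the two
     indicators vanishes. *)
  rewrite [leRHS](_ : _ = 0); last first.
    apply: big1 => x _; apply: big1 => y _.
    have [xy|_] := boolP (1 <= _ <= p)%N; last by rewrite mulr0.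
    have /forallP/(_ y)/implyP/(_ (power_adj_hdist xy)) := c_proper x.
    case: (c x =P a) => [->|]; last by rewrite !mul0r.
    by rewrite eq_sym => /negPf ->; rewrite mulr0 mul0r.
  rewrite -/s -/d => le0; rewrite -(ler_pM2r s_gt0) -subr_le0.
  by apply: le_trans le0; rewrite le_eqVlt; apply/orP; left; apply/eqP; ring.
have := ler_sum (index_enum 'I_k) (fun a (_ : true) => class_bound a).
rewrite -mulr_sumr -mulr_suml exchange_big /=.
(* Each vertex has exactly one colour, so the class sizes add up to [q^n]. *)
rewrite (eq_bigr (fun=> 1)); last first.
  move=> x _; rewrite (bigD1 (c x)) //= eqxx big1 ?addr0 // => a.
  by rewrite eq_sym => /negPf ->.
rewrite !sumr_const card_ffun !card_ord natrX mulfV ?mulr1; last first.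
  by rewrite expf_neq0 // pnatr_eq0 -lt0n.
move=> le_dm.
rewrite -(ler_pM2r Nm_gt0) mulrDl mul1r divfK ?gt_eqF //.
by rewrite addrC mulr_natl.
Qed.
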